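(* Let $(P_n(x))_{n\in\mathbb{N}_0}\subseteq\mathbb{R}[x]$ be a sequence given by $P_0(x)=1$, $P_1(x)=x$, $xP_n(x)=a_nP_{n+1}(x)+c_nP_{n-1}(x)$ $(n\in\mathbb{N})$ with $(c_n)_{n\in\mathbb{N}}\subseteq(0,1)$ and $a_n=1-c_n$, and assume that $(P_n(x))_{n\in\mathbb{N}_0}$ satisfies nonnegative linearization of products. If the dual space $\widehat{\mathbb{N}_0}$ coincides with the full interval $[-1,1]$, then $h(n)\geq 2$ for all $n\in\mathbb{N}$.
   Context: $\mathbb{N}=\{1,2,3,\ldots\}$ and $\mathbb{N}_0=\mathbb{N}\cup\{0\}$. A sequence $(P_n(x))_{n\in\mathbb{N}_0}$ given by such a recurrence satisfies $\deg P_n=n$ and $P_n(1)=1$ for all $n$, and it is orthogonal with respect to a unique probability Borel measure $\mu$ on $\mathbb{R}$, meaning that $\int_{\mathbb{R}}P_m(x)P_n(x)\,\mathrm{d}\mu(x)\neq 0\Leftrightarrow m=n$; one has $|\mathrm{supp}\,\mu|=\infty$ and $\mathrm{supp}\,\mu\subseteq[-1,1]$. Nonnegative linearization of products means that in the (unique) expansions $P_m(x)P_n(x)=\sum_{k=0}^{m+n}g(m,n;k)P_k(x)$ all coefficients $g(m,n;k)$ $(m,n,k\in\mathbb{N}_0)$ are nonnegative (in this case, the sequence induces a so-called polynomial hypergroup on $\mathbb{N}_0$). The dual space is $\widehat{\mathbb{N}_0}:=\{x\in\mathbb{R}:\max_{n\in\mathbb{N}_0}|P_n(x)|=1\}$.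 The Haar function is $h(n):=1/g(n,n;0)=1/\int_{\mathbb{R}}P_n^2(x)\,\mathrm{d}\mu(x)$; equivalently, $h(0)=1$ and $h(n)=\prod_{k=1}^n a_{k-1}/c_k$ for $n\in\mathbb{N}$, where $a_0:=1$. *)

(* Defs.v *)
From HB Require Import structures.
From mathcomp Require Import all_boot all_order all_algebra.
From mathcomp Require Import all_classical all_reals.

Set Implicit Arguments.
Unset Strict Implicit.
Unset Printing Implicit Defensive.

Import Order.TTheory GRing.Theory Num.Theory.
Local Open Scope classical_set_scope.
Local Open Scope ring_scope.

(* Only the values of a and c at positive indices are constrained; a 0 and c 0
   play no role. *)
Definition recurrence_polys (R : realType) (a c : nat -> R)
    (P : nat -> {poly R}) : Prop :=
  [/\ P 0%N = 1,
      P 1%N = 'X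
    & forall n : nat, (0 < n)%N ->
        'X * P n = a n *: P n.+1 + c n *: P n.-1].

(* g m n k stands for g(m,n;k). Since deg P_n = n for the sequences considered
   here, such a g exists and, thanks to the convention g(m,n;k) = 0 for
   k > m + n, is unique. *)
Definition linearization_coefs (R : realType) (P : nat -> {poly R})
    (g : nat -> nat -> nat -> R) : Prop :=
  (forall m n : nat, P m * P n = \sum_(k < (m + n).+1) g m n k *: P k) /\
  (forall m n k : nat, (m + n < k)%N -> g m n k = 0).

(* The first conjunct says that the maximum 1 is attained. *)
Definition dual_space (R : realType) (P : nat -> {poly R}) : set R :=
  [set x | let values := range (fun n : nat => `|(P n).[x]|) in
           values 1 /\ ubound values 1].

Definition haar (R : realType) (g : nat -> nat -> nat -> R) (n : nat) : R :=
  1 / g n n 0%N.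

(* Main.v *)
Require Import Defs.
From HB Require Import structures.
From mathcomp Require Import all_boot all_order all_algebra.
From mathcomp Require Import all_classical all_reals.
From mathcomp Require Import zify ring lra.

Set Implicit Arguments.
Unset Strict Implicit.
Unset Printing Implicit Defensive.

Import Order.TTheory GRing.Theory Num.Theory.
Local Open Scope classical_set_scope.
Local Open Scope ring_scope.

(** Since [P_n(1) = 1] for all [n], the coefficients [g(n,n;k)] are nonnegative
    with sum [1]. Let [x] be a zero of [P_n] in [[-1, 1]]. As [|P_k(x)| <= 1] for
    all [k], evaluating the expansion of [P_n ^ 2] at [x] gives
    [0 >= g(n,n;0) - (1 - g(n,n;0))], i.e. [h(n) >= 2]. The zero exists because
    the largest zeros of [P_n] increase with [n]. Moreover [g(n,n;0) != 0], as
    comparing [(X P_m) P_n] with [P_m (X P_n)] yields orthogonality and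
    [a_n g(n+1,n+1;0) = c_{n+1} g(n,n;0)]. *)

(** Induction on the size of [p], dividing out ['X - r] for a root [r]. If the quotient has a root
    in [[r, b]], its last one is also the last one of [p], so the left end moves to [r]; otherwise
    [r] itself is the last root. *)
Lemma poly_largest_root (F : rcfType) (p : {poly F}) (a b : F) :
    0 < p.[b] -> (exists2 x, a <= x <= b & root p x) ->
  exists s, [/\ a <= s < b, root p s & forall x, s < x <= b -> 0 < p.[x]].
Proof.
have [n] := ubnP (size p); elim: n p a => // n IHn p a szp pb [r /andP[ar rb]].
move=> rpr; have p_neq0 : p != 0.
  by apply: contraTneq pb => ->; rewrite horner0 ltxx.
have {}rb : r < b.
  by rewrite lt_neqAle rb andbT; apply: contraTneq pb => <-; rewrite (rootP rpr) ltxx.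
have /factor_theorem [q pE] := rpr.
have pxE x : p.[x] = q.[x] * (x - r) by rewrite pE hornerM hornerXsubC.
have qb : 0 < q.[b] by move: pb; rewrite pxE pmulr_lgt0 // subr_gt0.
have szq : (size q < n)%N.
  have q_neq0 : q != 0 by apply: contraNneq p_neq0 => q0; rewrite pE q0 mul0r.
  by move: szp; rewrite pE size_Mmonic ?monicXsubC // size_XsubC addn2 ltnS.
have [rootq|no_root] := pselect (exists2 x, r <= x <= b & root q x).
  have [s [/andP[rs sb] rqs q_gt0]] := IHn q r szq qb rootq.
  exists s; split; first by rewrite (le_trans ar rs).
    by rewrite rootE pxE (rootP rqs) mul0r.
  move=> x /andP[sx xb]; rewrite pxE mulr_gt0 ?subr_gt0 ?(le_lt_trans rs sx) //.
  by rewrite q_gt0 // sx.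
exists r; split => //; first by rewrite ar.
(* A value [q.[x] <= 0] would force a root of [q] in [[x, b]], because [q.[b] > 0]. *)
move=> x /andP[rx xb]; rewrite pxE mulr_gt0 ?subr_gt0 // ltNge; apply/negP => qx.
have [|y /andP[xy yb] rqy] := @poly_ivt _ q x b xb; first by rewrite qx ltW.
by apply: no_root; exists y; rewrite ?yb ?(le_trans (ltW rx) xy).
Qed.

(* Setting [c 0 = 0] makes the recurrence hold at [n = 0] as well, so
   that no case distinction is needed. *)
Definition total_recurrence (R : realType) (c : nat -> R) (P : nat -> {poly R}) :=
  [/\ P 0%N = 1, forall n, 0 <= c n < 1, forall n, 0 < c n.+1
    & forall n, 'X * P n = (1 - c n) *: P n.+1 + c n *: P n.-1].

Section Recurrence.
Context (R : realType) (c : nat -> R) (P : nat -> {poly R}).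
Context (P_rec : total_recurrence c P).

Let a_gt0 n : 0 < 1 - c n.
Proof. by case: P_rec => _ /(_ n) /andP[_ ?] _ _; rewrite subr_gt0. Qed.

Lemma horner_recurrence n x :
  x * (P n).[x] = (1 - c n) * (P n.+1).[x] + c n * (P n.-1).[x].
Proof.
have [_ _ _ /(_ n) /(congr1 (horner^~ x))] := P_rec.
by rewrite mulrC hornerMX hornerD !hornerZ mulrC.
Qed.

Lemma horner1_recurrence n : (P n).[1] = 1.
Proof.
suff: (P n).[1] = 1 /\ (P n.-1).[1] = 1 by case.
elim: n => [|n [IHn IHn1]] /=; first by case: P_rec => ->; rewrite hornerC.
split=> //; apply: (mulfI (lt0r_neq0 (a_gt0 n))).
by have := horner_recurrence n 1; rewrite IHn IHn1; lra.
Qed.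

Lemma size_recurrence n : size (P n) = n.+1.
Proof.
suff: size (P n) = n.+1 /\ (size (P n.-1) <= n.+1)%N by case.
elim: n => [|n [IHn IHn1]] /=; first by case: P_rec => ->; rewrite size_poly1.
split; last by rewrite IHn.
have [_ _ _ /(_ n)/esym/(canRL (addrK _)) rec] := P_rec.
have sizeXP : size (P n * 'X) = n.+2 by rewrite size_mulX ?IHn // -size_poly_gt0 IHn.
rewrite -(size_scale _ (lt0r_neq0 (a_gt0 n))) rec mulrC size_polyDl sizeXP //.
by rewrite size_polyN (leq_ltn_trans (size_scale_leq _ _)) // ltnS.
Qed.

(** The last clause carries the induction: at the largest zero [r] of [P n.+1] the recurrence makes
    [P n.+2] a negative multiple of [P n], hence negative, while its value at [1] is [1]. So its
    largest zero lies to the right of [r], where [P n.+1] is positive. *)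
Lemma recurrence_root n : exists r,
  [/\ -1 <= r < 1, (P n.+1).[r] = 0, forall x, r < x <= 1 -> 0 < (P n.+1).[x]
    & forall x, r <= x <= 1 -> 0 < (P n).[x]].
Proof.
have [P0 c_bounds c_gt0 _] := P_rec; elim: n => [|n [r [r_bounds Pr P_gt0 Pn_gt0]]].
  (* Since [0.-1 = 0], the recurrence at index [0] involves [P 0 = 1] twice, and the zero of [P 1]
     is [c 0]. *)
  have P1 x : x = (1 - c 0%N) * (P 1%N).[x] + c 0%N.
    by have := horner_recurrence 0 x; rewrite /= P0 hornerC !mulr1.
  have a0 := a_gt0 0; have /andP[c0 c1] := c_bounds 0%N.
  exists (c 0%N); split; first by rewrite c1 andbT (le_trans _ c0) // lerN10.
  - by apply: (mulfI (lt0r_neq0 a0)); have := P1 (c 0%N); lra.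
  - by move=> x /andP[cx _]; rewrite -(pmulr_rgt0 _ a0); have := P1 x; lra.
  - by move=> x _; rewrite P0 hornerC ltr01.
have /andP[r_ge r_lt] := r_bounds.
have Pn2r : (P n.+2).[r] < 0.
  have := horner_recurrence n.+1 r; rewrite Pr mulr0 /= => rec.
  rewrite -(pmulr_rlt0 _ (a_gt0 n.+1)).
  have : 0 < c n.+1 * (P n).[r] by rewrite mulr_gt0 // Pn_gt0 // lexx ltW.
  by lra.
have Pn21 : 0 < (P n.+2).[1] by rewrite horner1_recurrence ltr01.
have [|s [/andP[rs s1] /rootP Ps Ps_gt0]] := @poly_largest_root _ _ r 1 Pn21.
  by apply: poly_ivt; rewrite ?ltW.
have {}rs : r < s.
  by rewrite lt_neqAle rs andbT; apply: contraTneq Pn2r => ->; rewrite Ps ltxx.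
exists s; split=> //; first by rewrite s1 andbT ltW // (le_lt_trans r_ge).
by move=> x /andP[sx x1]; rewrite P_gt0 // x1 andbT (lt_le_trans rs).
Qed.

(** A nonzero top coefficient would write the last polynomial as a combination of polynomials of
    smaller degree. *)
Lemma expansion_eq0 N (d : nat -> R) :
  \sum_(k < N) d k *: P k = 0 -> forall k, (k < N)%N -> d k = 0.
Proof.
elim: N => // N IHN; rewrite big_ord_recr /= => sum0.
have dN : d N = 0.
  apply: contraFeq (ltnn N) => dN.
  have dNE : d N *: P N = - \sum_(k < N) d k *: P k.
    by apply/eqP; rewrite -addr_eq0 addrC sum0.
  rewrite -[X in (X <= _)%N]size_recurrence -(size_scale _ dN) dNE size_polyN.
  rewrite (leq_trans (size_sum _ _ _)) //; apply/bigmax_leqP => k _.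
  by rewrite (leq_trans (size_scale_leq _ _)) // size_recurrence.
move: sum0; rewrite dN scale0r addr0 => /IHN d0 k.
by rewrite ltnS leq_eqVlt => /predU1P[->|/d0].
Qed.

Context (g : nat -> nat -> nat -> R) (g_lin : linearization_coefs P g).

Lemma linearization_widen N m n : (m + n < N)%N ->
  P m * P n = \sum_(k < N) g m n k *: P k.
Proof.
move=> mnN; have [-> g0] := g_lin.
rewrite (big_ord_widen N (fun k => g m n k *: P k)) //.
rewrite [RHS](bigID (fun k : 'I_N => (k < (m + n).+1)%N)) /=.
rewrite [X in _ + X]big1 ?addr0 // => k; rewrite -leqNgt => /g0 ->.
by rewrite scale0r.
Qed.

Lemma linearization_recurrence m n k :
  (1 - c m) * g m.+1 n k + c m * g m.-1 n k =
  (1 - c n) * g m n.+1 k + c n * g m n.-1 k.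
Proof.
(* This bound exceeds both [k] and [m + n + 1], so all four products expand over one index range. *)
pose N := (m + n + k).+2; have [_ _ _ rec] := P_rec.
pose d k := (1 - c m) * g m.+1 n k + c m * g m.-1 n k -
  ((1 - c n) * g m n.+1 k + c n * g m n.-1 k).
apply/eqP; rewrite -subr_eq0; apply/eqP; apply: (@expansion_eq0 N d); last by lia.
transitivity ('X * P m * P n - P m * ('X * P n)); last by ring.
rewrite !rec mulrDl mulrDr -!scalerAl -!scalerAr.
rewrite !(@linearization_widen N); try by lia.
rewrite !scaler_sumr -!big_split -sumrB /=; apply: eq_bigr => i _.
by rewrite /d !scalerA -!scalerDl -scalerBl.
Qed.

(** The recurrence reduces [g m.+1 n 0] to values whose first index is smaller and still below the
    second; the base case is [P 0 * P n = P n]. *)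
Lemma linearization_orthogonal m n : (m < n)%N -> g m n 0%N = 0.
Proof.
elim/ltn_ind: m n => -[|m] IHm n mn.
  have [P0 _ _ _] := P_rec.
  pose d k := g 0%N n k - (k == n)%:R.
  have <- : d 0%N = 0.
    apply: (@expansion_eq0 n.+1 d) => //; rewrite /d.
    under eq_bigr do rewrite scalerBl.
    rewrite sumrB -(@linearization_widen n.+1 0 n) // P0 mul1r.
    rewrite (bigD1 ord_max) //= eqxx scale1r big1 ?addr0 ?subrr // => i.
    by rewrite -val_eqE /= => /negPf ->; rewrite scale0r.
  by rewrite /d ltn_eqF // subr0.
apply: (mulfI (lt0r_neq0 (a_gt0 m))); have := linearization_recurrence m n 0.
by rewrite !(IHm m) ?(IHm m.-1) //; try lia; lra.
Qed.

(** As [1 / 0 = 0] here, the bound on [haar] depends on this. In the recurrence at [(n, n.+1)],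
    orthogonality leaves only the two diagonal terms. *)
Lemma linearization_diag_neq0 n : g n n 0%N != 0.
Proof.
have [P0 _ c_gt0 _] := P_rec; elim: n => [|n IHn].
  have := @linearization_widen 1 0 0 isT; rewrite big_ord1 P0 mul1r => E.
  by apply: contraTneq (oner_neq0 {poly R}) => g0; rewrite E g0 scale0r eqxx.
have := linearization_recurrence n n.+1 0.
rewrite (@linearization_orthogonal n n.+2) ?(@linearization_orthogonal n.-1) //; try lia.
rewrite !mulr0 add0r addr0 /= => E; have : c n.+1 * g n n 0%N != 0.
  exact: mulf_neq0 (lt0r_neq0 (c_gt0 n)) IHn.
by rewrite -E mulf_eq0 negb_or => /andP[].
Qed.

End Recurrence.

Theorem theorem2p1 (R : realType) (a c : nat -> R) (P : nat -> {poly R})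
    (g : nat -> nat -> nat -> R)
    (c_bounds : forall n : nat, (0 < n)%N -> 0 < c n < 1)
    (aE : forall n : nat, (0 < n)%N -> a n = 1 - c n)
    (P_rec : recurrence_polys a c P)
    (g_lin : linearization_coefs P g)
    (g_ge0 : forall m n k : nat, 0 <= g m n k)
    (dualE : dual_space P = `[(-1 : R), 1]%classic) :
  forall n : nat, (0 < n)%N -> 2 <= haar g n.
Proof.
have [P0 P1 rec] := P_rec.
have {P_rec rec} P_rec : total_recurrence (fun n => if n is 0 then 0 else c n) P.
  split=> // [[|n]|n|[|n]].
  - by rewrite lexx ltr01.
  - by have /andP[/ltW-> ->] := c_bounds n.+1 isT.
  - by have /andP[] := c_bounds n.+1 isT.
  - by rewrite P0 P1 mulr1 subr0 scale1r scale0r addr0.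
  - by rewrite rec // aE.
case=> // n _; have [x [/andP[x_ge x_lt] Px _ _]] := recurrence_root P_rec n.
have [_ Pk_le1] : dual_space P x by rewrite dualE /= in_itv /= x_ge ltW.
have {}Pk_le1 k : - 1 <= (P k).[x].
  by have : `|(P k).[x]| <= 1 by [apply: Pk_le1; exists k]; rewrite ler_norml => /andP[].
have g_gt0 : 0 < g n.+1 n.+1 0%N by rewrite lt_def (linearization_diag_neq0 P_rec g_lin) g_ge0.
have /[dup] := g_lin.1 n.+1 n.+1; rewrite big_ord_recl P0.
move=> /(congr1 (horner^~ x)) + /(congr1 (horner^~ 1)).
rewrite /= !hornerM !hornerD !hornerZ !hornerC !horner_sum Px.
rewrite !(horner1_recurrence P_rec) mulr0 !mulr1.
(* With [G = g n.+1 n.+1 0], evaluation at [x] gives [0 = G + Sx] and evaluation at [1] gives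
   [1 = G + S1]. *)
set Sx := \sum_(i < _) _ => Sx0; set S1 := \sum_(i < _) _ => S11.
have S_le : - S1 <= Sx.
  rewrite -sumrN; apply: ler_sum => i _.
  by rewrite !hornerZ (horner1_recurrence P_rec) mulr1 -mulrN1 ler_wpM2l.
by rewrite /haar ler_pdivlMr //; lra.
Qed.
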